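(* For every integer $k\geq 1$, $$\sum_{\iota\in\mathcal{I}_{2k}(123)} q^{\mathrm{coinv}(\iota)} = \sum_{j=1}^k B_{2j+1,k-j}(q^2) + \sum_{j=1}^k q^{2j-1} A_{2j,k-j}(q^2).$$
   Context: A permutation $\sigma$ of $[n]$ (one-line notation) contains a pattern $\pi\in\mathfrak{S}_k$ if some subsequence $\sigma(m_1)\cdots\sigma(m_k)$ with $m_1<\dots<m_k$ is in the same relative order as $\pi$; otherwise it avoids $\pi$. $\mathcal{I}_n(\pi)$ is the set of involutions ($\iota^2=\mathrm{id}$) of $[n]$ avoiding $\pi$. $\mathrm{coinv}(\sigma)$ is the number of pairs $i<j$ with $\sigma(i)<\sigma(j)$. For positive integers $m$ and $\ell\ge 0$, $A_{m,\ell}$ is the set of sequences $(a_1,\dots,a_\ell)$ of positive integers such that: (1) $a_1\le m$; (2) if $a_1,\dots,a_i$ are all equal to $1$ then $a_{i+1}\le m+i$; (3) if $a_i\ne 1$ and $a_{i+1},\dots,a_{i+r}$ are all equal to $1$ (for some $r\ge 0$) then $a_{i+r+1}\le a_i+r$. (For $\ell=0$, $A_{m,0}$ consists of the empty sequence.) Let $B_{m,\ell}=\{(a_1,\dots,a_\ell)\in A_{m,\ell}: a_1\neq 1\}$. Define $A_{m,\ell}(q)=\sum_{(a_1,\dots,a_\ell)\in A_{m,\ell}} q^{a_1+\dots+a_\ell-\ell}$ and $B_{m,\ell}(q)$ analogously over $B_{m,\ell}$. *)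

(* Defs.v *)
From HB Require Import structures.
From mathcomp Require Import all_boot all_order all_fingroup all_algebra zify.

Set Implicit Arguments.
Unset Strict Implicit.
Unset Printing Implicit Defensive.

Import GRing.Theory.

(* Permutations of [n] are elements of 'S_n, i.e. [n] is shifted to
   {0, ..., n-1}; this affects neither patterns nor coinversions. *)

Definition contains (n k : nat) (s : 'S_n) (p : 'S_k) : bool :=
  [exists m : {ffun 'I_k -> 'I_n},
     [forall a : 'I_k, forall b : 'I_k, (a < b) ==> (m a < m b)]
  && [forall a : 'I_k, forall b : 'I_k, (s (m a) < s (m b)) == (p a < p b)]].

Definition avoids (n k : nat) (s : 'S_n) (p : 'S_k) : bool := ~~ contains s p.

Definition involutions_avoiding (n k : nat) (p : 'S_k) : {set 'S_n} :=
  [set s : 'S_n | [forall i, s (s i) == i] && avoids s p].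

(* The pattern 123 is the identity of 'S_3. *)
Definition pattern123 : 'S_3 := 1%g.

Definition coinv (n : nat) (s : 'S_n) : nat :=
  #|[set ij : 'I_n * 'I_n | (ij.1 < ij.2) && (s ij.1 < s ij.2)]|.

(* Membership of a = (a_1, ..., a_l) in A_{m,l}.  The entry a_{i+1} is
   nth 0 a i, so that in the last clause (i, i + r + 1) stands for the
   one-based (i + 1, i + r + 2); r < l is implied by i + r + 1 < l. *)
Definition in_A (m l : nat) (a : seq nat) : bool :=
  [&& size a == l,
      all (fun x => 0 < x) a,
      (0 < l) ==> (nth 0 a 0 <= m),
      [forall i : 'I_l, all (pred1 1) (take i a) ==> (nth 0 a i <= m + i)]
    & [forall i : 'I_l, forall r : 'I_l,
         [&& i + r + 1 < l, nth 0 a i != 1 & all (pred1 1) (take r (drop i.+1 a))]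
           ==> (nth 0 a (i + r + 1) <= nth 0 a i + r)]].

(* For l = 0 the condition a_1 <> 1 is vacuous: the empty sequence belongs
   to B_{m,0}. *)
Definition in_B (m l : nat) (a : seq nat) : bool :=
  in_A m l a && (ohead a != Some 1).

Definition vals (N l : nat) (t : l.-tuple 'I_N) : seq nat := map val t.

(* The entries of a member of A_{m,l} are at most m + l (see A_set_complete),
   so A_{m,l} and B_{m,l} are encoded as finite sets of tuples over
   {0, ..., m + l}. *)
Definition A_set (m l : nat) : {set l.-tuple 'I_(m + l).+1} :=
  [set t | in_A m l (vals t)].

Definition B_set (m l : nat) : {set l.-tuple 'I_(m + l).+1} :=
  [set t | in_B m l (vals t)].

Lemma in_A_bound m l a i : in_A m l a -> i < l -> nth 0 a i <= m + i.
Proof.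
case/and5P=> /eqP sz _ _ /forallP H2 /forallP H3.
elim/ltn_ind: i => i IH lt_il.
have [h1|] := boolP (all (pred1 1) (take i a)).
  by have /implyP := H2 (Ordinal lt_il); apply.
move=> nall.
have exP : exists j, (j < i) && (nth 0 a j != 1).
  move: nall; rewrite -has_predC => /(has_nthP 0)[j]; rewrite size_take sz lt_il => lt_ji /=.
  by rewrite nth_take // => nj; exists j; rewrite lt_ji.
have ub j : (j < i) && (nth 0 a j != 1) -> j <= i by case/andP=> /ltnW.
case: (ex_maxnP exP ub) => j /andP[lt_ji nj] jmax.
have lt_jl := ltn_trans lt_ji lt_il.
have lt_rl : i - j.+1 < l by lia.
have /forallP/(_ (Ordinal lt_rl))/implyP := H3 (Ordinal lt_jl).
have -> : Ordinal lt_jl + Ordinal lt_rl + 1 = i by rewrite /=; lia.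
move=> /= H; apply: (leq_trans (H _)); last first.
  by have := IH j lt_ji lt_jl; lia.
rewrite lt_il nj /=; apply/(all_nthP 0) => u.
rewrite size_take size_drop sz => lt_u.
have {}lt_u : u < i - j.+1 by move: lt_u; case: ifP; lia.
rewrite nth_take // nth_drop /=; apply/negPn/negP => nu.
by have := jmax (j.+1 + u); rewrite nu andbT; lia.
Qed.

Lemma A_set_complete m l a :
  in_A m l a <-> exists2 t, t \in A_set m l & vals t = a.
Proof.
split=> [ha|[t + <-]]; last by rewrite inE.
have /and5P[/eqP sz _ _ _ _] := ha.
have E : vals [tuple inord (nth 0 a i) : 'I_(m + l).+1 | i < l] = a.
  apply: (@eq_from_nth _ 0); first by rewrite size_map size_tuple sz.
  rewrite size_map size_tuple => i lt_il.
  rewrite (nth_map ord0) ?size_tuple //.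
  rewrite -[i]/(val (Ordinal lt_il)) -tnth_nth tnth_mktuple /= inordK //.
  by have := in_A_bound ha lt_il; lia.
by exists [tuple inord (nth 0 a i) : 'I_(m + l).+1 | i < l]; rewrite ?inE E.
Qed.

Lemma B_set_complete m l a :
  in_B m l a <-> exists2 t, t \in B_set m l & vals t = a.
Proof.
split=> [hb|[t + <-]]; last by rewrite inE.
have /andP[/A_set_complete[t _ E] _] := hb.
by exists t; rewrite ?inE E.
Qed.

Local Open Scope ring_scope.

(* The exponent is a natural number subtraction, but every entry is at least
   1, so nothing is truncated. *)
Definition A_poly (m l : nat) : {poly int} :=
  \sum_(t in A_set m l) 'X^(sumn (vals t) - l).

Definition B_poly (m l : nat) : {poly int} :=
  \sum_(t in B_set m l) 'X^(sumn (vals t) - l).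

(* Main.v *)
Require Import Defs.
From mathcomp Require Import all_boot all_order all_fingroup all_algebra zify.
Import GRing.Theory.

Set Implicit Arguments.
Unset Strict Implicit.
Unset Printing Implicit Defensive.

(* A 123-avoiding involution of [2k] is stripped of the 2-cycle through its
   first point, and renormalised, until it becomes decreasing or its first point
   is fixed; in the latter case 123-avoidance forces the remaining entries to
   decrease.  Conversely, let h be the largest lower entry of a coinversion of a
   123-avoiding involution of [n] (h = 0 if there is none) and put
   c = n + 1 - h.  Adjoining the cycle (1, n + 3 - a) keeps 123 avoided exactly
   when 1 <= a <= c, and adds 2(a - 1) coinversions; the new value of c is a if
   a <> 1, and c + 1 if a = 1 and h <> 0.  This is the rule defining A_{c,l}.
   Starting from 1 n (n-1) ... 2 with n = 2j, where c = 2j and coinv = 2j - 1,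
   gives the second sum.  Starting from the last decreasing involution met, of
   size 2j with c = 2j + 1, so that the next a is not 1, gives the first. *)

(** * Increasing triples, lower entries and coinversions *)

Definition increasing_triple_free n (s : 'S_n) :=
  forall i j k : 'I_n, i < j -> j < k -> s i < s j -> s j < s k -> False.

Lemma avoids123P n (s : 'S_n) :
  reflect (increasing_triple_free s) (avoids s pattern123).
Proof.
apply: (iffP negP) => [nc i j k ij jk sij sjk | av /existsP[m]].
  apply: nc; apply/existsP; exists [ffun a : 'I_3 => nth i [:: i; j; k] a].
  apply/andP; split; apply/'forall_forallP => -[[|[|[|//]]] ?] [[|[|[|//]]] ?];
    rewrite !ffunE /= ?perm1 /=; lia.
case/andP=> /'forall_forallP mono /'forall_forallP sm.
have o1 : 1 < 3 by []. have o2 : 2 < 3 by [].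
apply: (av (m ord0) (m (Ordinal o1)) (m (Ordinal o2))).
- exact: (implyP (mono _ _)).
- exact: (implyP (mono _ _)).
- by rewrite (eqP (sm _ _)) !perm1.
- by rewrite (eqP (sm _ _)) !perm1.
Qed.

Lemma in_involutions123 n (s : 'S_n) :
  reflect (involutive s /\ increasing_triple_free s)
          (s \in involutions_avoiding n pattern123).
Proof.
rewrite inE; apply: (iffP andP) => -[/= inv av]; split.
- by move=> i; apply/eqP; have /forallP := inv.
- exact/avoids123P.
- by apply/forallP => i; rewrite inv.
- exact/avoids123P.
Qed.

(* The largest lower entry of a coinversion, counted from 1, so that the value
   0 characterises the decreasing permutation. *)
Definition max_low n (s : 'S_n) : nat :=
  \max_(p : 'I_n * 'I_n | (p.1 < p.2) && (s p.1 < s p.2)) (s p.1).+1.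

Lemma max_low_leP n (s : 'S_n) m :
  reflect (forall i j : 'I_n, i < j -> s i < s j -> s i < m) (max_low s <= m).
Proof.
apply: (iffP (bigmax_leqP _ _ _)) => [H i j ij sij | H [i j] /= /andP[]].
  by apply: (H (i, j)); rewrite /= ij.
exact: H.
Qed.

Lemma max_low_ge n (s : 'S_n) (i j : 'I_n) :
  i < j -> s i < s j -> s i < max_low s.
Proof. by move=> ij sij; apply: (max_low_leP s (max_low s) _ i j). Qed.

Lemma coinv_sum m (s : 'S_m) :
  coinv s = \sum_(i < m) \sum_(j < m) ((i < j) && (s i < s j)).
Proof.
rewrite pair_big /= /coinv -sum1dep_card big_mkcond.
by apply: eq_bigr => -[i j] _ /=; case: (_ && _).
Qed.

(** * Adjoining and removing the 2-cycle through the first point *)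

Lemma lift_perm_surj n (i j : 'I_n.+1) (s : 'S_n.+1) :
  s i = j -> exists t, s = lift_perm i j t.
Proof.
move=> sij.
have liftK k : exists k', s (lift i k) = lift j k'.
  case: (unliftP j (s (lift i k))) => [k' ->|]; first by exists k'.
  by rewrite -sij => /perm_inj /eqP; rewrite eq_sym (negPf (neq_lift i k)).
have [f fE] := fin_all_exists liftK.
have f_inj : injective f.
  by move=> x y fxy; apply: (@lift_inj _ i); apply: (@perm_inj _ s); rewrite !fE fxy.
exists (perm f_inj); apply/permP => x.
case: (unliftP i x) => [k ->|->]; last by rewrite lift_perm_id.
by rewrite lift_perm_lift permE fE.
Qed.

(* Adjoins to t the 2-cycle exchanging 0 and w + 1. *)
Definition add_cycle n (w : 'I_n.+1) (t : 'S_n) : 'S_n.+2 :=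
  lift_perm ord0 (lift ord0 w) (lift_perm w ord0 t).

Section AddCycle.
Variables (n : nat) (w : 'I_n.+1).
Implicit Type t : 'S_n.

Definition old (k : 'I_n) : 'I_n.+2 := lift ord0 (lift w k).

Lemma add_cycle_first t : add_cycle w t ord0 = lift ord0 w.
Proof. exact: lift_perm_id. Qed.

Lemma add_cycle_second t : add_cycle w t (lift ord0 w) = ord0.
Proof. by rewrite lift_perm_lift lift_perm_id; apply: val_inj. Qed.

Lemma add_cycle_old t k : add_cycle w t (old k) = old (t k).
Proof.
rewrite !lift_perm_lift; apply: val_inj; rewrite /= /bump /=; lia.
Qed.

Lemma old_inj : injective old.
Proof. by move=> x y /lift_inj /lift_inj. Qed.

Lemma ltn_old i j : (old i < old j) = (i < j).
Proof. rewrite /= /bump /=; lia. Qed.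

Variant cycle_split_spec : 'I_n.+2 -> Type :=
| CycleFirst : cycle_split_spec ord0
| CycleSecond : cycle_split_spec (lift ord0 w)
| CycleOld k : cycle_split_spec (old k).

Lemma cycle_splitP i : cycle_split_spec i.
Proof.
case: (unliftP ord0 i) => [j ->|->]; last exact: CycleFirst.
case: (unliftP w j) => [k ->|->]; [exact: CycleOld | exact: CycleSecond].
Qed.

Lemma sum_cycle_split (F : 'I_n.+2 -> nat) :
  \sum_i F i = F ord0 + F (lift ord0 w) + \sum_k F (old k).
Proof. by rewrite (bigD1_ord ord0) // (bigD1_ord w) //= addnA. Qed.

Lemma add_cycle_involutive t : involutive (add_cycle w t) <-> involutive t.
Proof.
split=> inv i.
  by apply: old_inj; rewrite -!add_cycle_old inv.
case: (cycle_splitP i) => [||k].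
- by rewrite add_cycle_first add_cycle_second.
- by rewrite add_cycle_second add_cycle_first.
- by rewrite !add_cycle_old inv.
Qed.

(** A triple through a new point starts there and continues with a coinversion of [t], whose lower
    entry has value at least [w] (after the first point) or position at least [w] (after the
    second). An involution exchanges positions and values of coinversions, so bounding values by
    [max_low t] excludes both. *)
Lemma add_cycle_triple_free t : involutive t ->
  increasing_triple_free (add_cycle w t) <->
  increasing_triple_free t /\ max_low t <= w.
Proof.
move=> inv; split=> [av | [av /max_low_leP low]].
  split=> [i j k ij jk tij tjk|].
    by apply: (av (old i) (old j) (old k)); rewrite ?add_cycle_old ltn_old.
  apply/max_low_leP => i j ij tij; rewrite ltnNge; apply/negP => le_w.
  apply: (av ord0 (old i) (old j)); rewrite ?add_cycle_old ?add_cycle_first ?ltn_old //.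
  by rewrite /= /bump /=; lia.
have low' (i j : 'I_n) : i < j -> t i < t j -> i < w.
  by move=> ij tij; rewrite -{1}(inv i); apply: (low (t i) (t j)); rewrite ?inv.
move=> i j k; case: (cycle_splitP i) => [||i'];
  case: (cycle_splitP j) => [||j'];  case: (cycle_splitP k) => [||k'];
  rewrite ?add_cycle_first ?add_cycle_second ?add_cycle_old ?ltn_old //.
- by move=> _ jk lt_w /(low _ _ jk); move: lt_w; rewrite /= /bump /=; lia.
- by move=> lt_w jk _ /(low' _ _ jk); move: lt_w; rewrite /= /bump /=; lia.
- exact: av.
Qed.

Lemma sum_geq_ord : \sum_(k < n) (w <= k) = n - w.
Proof.
have -> : \sum_(k < n) (w <= k) = \sum_(0 <= k < n) (w <= k) by rewrite big_mkord.
have le_wn : w <= n by rewrite -ltnS.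
rewrite (@big_cat_nat _ _ _ w) //= [X in X + _]big_nat_cond big1 ?add0n; last first.
  by move=> i; rewrite andbT => /andP[_ lt_iw]; rewrite leqNgt lt_iw.
rewrite -[RHS]muln1 -sum_nat_const_nat; apply: eq_big_nat => i /andP[-> _] //.
Qed.

(** A new point can only be the lower end of a coinversion. The first pairs with the old points of
    value at least [w], the second with those at position at least [w]: [n - w] each time. *)
Lemma coinv_add_cycle t : coinv (add_cycle w t) = coinv t + 2 * (n - w).
Proof.
rewrite !coinv_sum sum_cycle_split !sum_cycle_split.
rewrite (add_cycle_first t) (add_cycle_second t).
under [X in _ + _ + X]eq_bigr => i _.
  rewrite sum_cycle_split (add_cycle_first t) (add_cycle_second t) add_cycle_old.
  rewrite [X in X + _](_ : _ = 0); last by rewrite /= /bump /=; lia.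
  under eq_bigr => j _ do rewrite add_cycle_old !ltn_old.
  over.
rewrite /= add0n addnC; congr (_ + _).
rewrite (_ : \sum_k _ = n - w); last first.
  rewrite -sum_geq_ord [RHS](reindex_perm t) /=; apply: eq_bigr => k _.
  by rewrite add_cycle_old /= /bump /=; lia.
rewrite (_ : \sum_k _ = n - w); last first.
  rewrite -sum_geq_ord; apply: eq_bigr => k _.
  by rewrite add_cycle_old /= /bump /=; lia.
rewrite /bump /=; lia.
Qed.

Lemma max_low_add_cycle_lt t : max_low t <= w -> w < n ->
  max_low (add_cycle w t) = w.+2.
Proof.
move=> /max_low_leP low lt_wn; apply/eqP; rewrite eqn_leq; apply/andP; split.
  apply/max_low_leP => i j; case: (cycle_splitP i) => [||i'];
  case: (cycle_splitP j) => [||j'];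
  rewrite ?add_cycle_first ?add_cycle_second ?add_cycle_old ?ltn_old //.
  by move=> ij /(low _ _ ij); rewrite /= /bump /=; lia.
(* The first point has value [w + 1], and the old point of value [w], now [w + 2], lies above it. *)
have := @max_low_ge _ (add_cycle w t) ord0 (old ((t^-1)%g (Ordinal lt_wn))).
rewrite add_cycle_first add_cycle_old permKV /= /bump /=; lia.
Qed.

End AddCycle.

(** The new points hold the extreme values and positions, so they enter no coinversion; the old
    values rise by one. The boolean keeps 0 at 0 when there is no coinversion. *)
Lemma max_low_add_cycle_max n (t : 'S_n) :
  max_low (add_cycle ord_max t) = (0 < max_low t) + max_low t.
Proof.
have oldE (k : 'I_n) : old ord_max k = k.+1 :> nat.
  by rewrite /= /bump /=; have := ltn_ord k; lia.
apply/eqP; rewrite eqn_leq; apply/andP; split.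
  apply/max_low_leP => i j; case: (cycle_splitP ord_max i) => [||i'];
  case: (cycle_splitP ord_max j) => [||j'];
  rewrite ?add_cycle_first ?add_cycle_second ?add_cycle_old ?ltn_old //.
  - by rewrite oldE /= /bump /=; have := ltn_ord (t j'); lia.
  - by rewrite oldE /= /bump /=; have := ltn_ord j'; lia.
  - by move=> ij /(max_low_ge ij); rewrite oldE; lia.
case: (posnP (max_low t)) => [-> //|pos].
rewrite add1n -{1}(prednK pos) ltnNge; apply/negP => le.
suff : max_low t <= (max_low t).-1 by lia.
apply/max_low_leP => i j ij tij.
have := @max_low_ge _ (add_cycle ord_max t) (old ord_max i) (old ord_max j).
rewrite !add_cycle_old !ltn_old oldE => /(_ ij tij); lia.
Qed.

Lemma add_cycle_surj n (s : 'S_n.+2) : involutive s -> s ord0 != ord0 ->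
  exists w t, s = add_cycle w t.
Proof.
move=> inv; case: (unliftP ord0 (s ord0)) => [w s0 _ | ->]; last by rewrite eqxx.
have [s' sE] := lift_perm_surj s0.
(* Since [s] is an involution, the point [w + 1] returns to 0, which allows a second deletion. *)
have s'w : s' w = ord0.
  have : s (lift ord0 w) = ord0 by rewrite -s0 inv.
  rewrite sE lift_perm_lift => /(congr1 val) /=; rewrite /bump => v0.
  by apply: val_inj => /=; lia.
by have [t s'E] := lift_perm_surj s'w; exists w, t; rewrite sE s'E.
Qed.

Lemma add_cycle_inj n (w w' : 'I_n.+1) (t t' : 'S_n) :
  add_cycle w t = add_cycle w' t' -> w = w' /\ t = t'.
Proof.
move=> E; have ww : w = w'.
  by apply: (@lift_inj _ ord0); rewrite -(add_cycle_first w t) E add_cycle_first.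
split=> //; apply/permP => k; apply: (@old_inj _ w).
by rewrite -add_cycle_old E -ww add_cycle_old.
Qed.

(** * The starting permutations: decreasing, and with fixed first point *)

Definition rev_perm n : 'S_n := perm (@rev_ord_inj n).

Lemma max_low_eq0 n (s : 'S_n) : (max_low s == 0) = (s == rev_perm n).
Proof.
rewrite -leqn0; apply/max_low_leP/eqP => [dec | -> i j ij]; last first.
  by rewrite !permE /=; have := ltn_ord j; lia.
have {}dec (i j : 'I_n) : i < j -> s j < s i.
  move=> ij; rewrite ltnNge leq_eqVlt; apply/negP => /orP[/eqP/val_inj/perm_inj E|/(dec _ _ ij) //].
  by rewrite E ltnn in ij.
(* Strict decrease pins every value: induction from the left end bounds it above, induction from the
   right end bounds it below. *)
have upper m : forall i : 'I_n, i = m :> nat -> s i + i < n.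
  elim: m => [|m IH] i im; first by rewrite im addn0.
  have lt_mn : m < n by have := ltn_ord i; lia.
  have := IH (Ordinal lt_mn) erefl.
  have := dec (Ordinal lt_mn) i; rewrite im /=; lia.
have lower m : forall i : 'I_n, n = m + i.+1 -> m <= s i.
  elim: m => [//|m IH] i nE.
  have lt_in : i.+1 < n by lia.
  have := IH (Ordinal lt_in); have := dec i (Ordinal lt_in); rewrite /=; lia.
apply/permP => i; apply: val_inj; rewrite permE /=.
have := upper i i erefl; have := lower (n - i.+1) i; have := ltn_ord i; lia.
Qed.

Lemma coinv_rev n : coinv (rev_perm n) = 0.
Proof.
apply/eqP; rewrite cards_eq0; apply/eqP/setP => -[i j]; rewrite !inE /= !permE /=.
have := ltn_ord j; lia.
Qed.

Lemma rev_perm_involution123 n :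
  rev_perm n \in involutions_avoiding n pattern123.
Proof.
apply/in_involutions123; split=> [i | i j k ij _].
  by rewrite !permE rev_ordK.
rewrite !permE /=; have := ltn_ord j; lia.
Qed.

Lemma max_low_rev n : max_low (rev_perm n) = 0.
Proof. by apply/eqP; rewrite max_low_eq0. Qed.

Definition fix0_rev n : 'S_n.+1 := lift_perm ord0 ord0 (rev_perm n).

Lemma fix0_involution123 n (s : 'S_n.+1) :
  (s \in involutions_avoiding n.+1 pattern123) && (s ord0 == ord0) =
  (s == fix0_rev n).
Proof.
apply/andP/eqP => [[/in_involutions123[inv av] /eqP s0] | ->]; last first.
  rewrite lift_perm_id eqxx; split=> //; apply/in_involutions123; split.
    move=> i; case: (unliftP ord0 i) => [j ->|->]; last by rewrite !lift_perm_id.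
    by rewrite !lift_perm_lift !permE rev_ordK.
  move=> i j k; case: (unliftP ord0 j) => [j' ->|->] //.
  case: (unliftP ord0 k) => [k' ->|->] // _ jk _.
  by rewrite !lift_perm_lift !permE; move: jk; rewrite /= /bump /=; lia.
have [t sE] := lift_perm_surj s0; rewrite sE; congr lift_perm.
apply/eqP; rewrite -max_low_eq0 -leqn0; apply/max_low_leP => i j ij tij.
exfalso; apply: (av ord0 (lift ord0 i) (lift ord0 j));
  by rewrite ?sE ?lift_perm_id ?lift_perm_lift.
Qed.

Lemma coinv_fix0_rev n : coinv (fix0_rev n) = n.
Proof.
rewrite coinv_sum big_ord_recl /= [X in _ + X]big1 => [|i _].
  rewrite addn0 big_ord_recl add0n.
  under eq_bigr => j _ do rewrite lift_perm_id lift_perm_lift /=.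
  by rewrite sum_nat_const card_ord muln1.
rewrite big1 // => j _; case: (unliftP ord0 j) => [j' ->|->] //.
rewrite !lift_perm_lift !permE /= /bump /=; have := ltn_ord j'; lia.
Qed.

(** The size [n.+2] provides a second point, so the fixed point 0 is the lower end of a coinversion,
    and only it can be. *)
Lemma max_low_fix0_rev n : max_low (fix0_rev n.+1) = 1.
Proof.
apply/eqP; rewrite eqn_leq; apply/andP; split.
  apply/max_low_leP => i j; case: (unliftP ord0 i) => [i' ->|->]; last by rewrite lift_perm_id.
  case: (unliftP ord0 j) => [j' ->|->] // ij; rewrite !lift_perm_lift !permE /=.
  by move: ij; rewrite /= /bump /=; have := ltn_ord j'; lia.
have := @max_low_ge _ (fix0_rev n.+1) ord0 (lift ord0 ord0).
by rewrite lift_perm_id lift_perm_lift; apply.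
Qed.

(** * Removing the first letter of a sequence *)

(** The tail obeys the same rules with a new bound: its initial run of ones is governed by clause
    (2) of the whole sequence if [a] is 1, giving [m + 1], and by clause (3) at the first letter
    otherwise, giving [a]. *)
Lemma in_A_cons m l a s :
  in_A m l.+1 (a :: s) =
  (0 < a <= m) && in_A (if a == 1 then m.+1 else a) l s.
Proof.
apply/idP/idP.
  case/and5P=> /eqP [sz] /andP[a_gt0 pos] /= le_am /forallP H2 /forallP H3.
  set m' := if _ then _ else _.
  have H2' (i : 'I_l) : all (pred1 1) (take i s) -> nth 0 s i <= m' + i.
    move=> ones; rewrite /m'; case: eqP => [a1 | /eqP an1].
      have /implyP := H2 (lift ord0 i); rewrite lift0 /= a1 eqxx ones => /(_ isT).
      lia.
    have lt_il : i < l.+1 by have := ltn_ord i; lia.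
    have /forallP/(_ (Ordinal lt_il))/implyP := H3 ord0.
    rewrite /= add0n addn1 /= ltnS ltn_ord an1 drop0 ones; exact.
  rewrite /= a_gt0 le_am /=; apply/and5P; split=> //; first by rewrite sz.
  - apply/implyP => l_gt0; have := H2' (Ordinal l_gt0); rewrite /= take0 addn0; exact.
  - by apply/forallP => i; apply/implyP; apply: H2'.
  - apply/forallP => i; apply/forallP => r; apply/implyP => /and3P[lt_l sn1 ones].
    have lt_rl : r < l.+1 by have := ltn_ord r; lia.
    have /forallP/(_ (Ordinal lt_rl))/implyP := H3 (lift ord0 i).
    by rewrite lift0 /= addSn addn1 /= sn1 ones ltnS -addn1 lt_l; apply.
case/andP=> /andP[a_gt0 le_am] /and5P[/eqP sz pos _ /forallP H2 /forallP H3].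
apply/and5P; split=> //=; rewrite ?sz ?a_gt0 //.
- apply/forallP => i; case: (unliftP ord0 i) => [j ->|->]; last by rewrite /= addn0 le_am.
  rewrite lift0 /=; apply/implyP => /andP[/eqP a1 ones].
  by have /implyP/(_ ones) := H2 j; rewrite a1 /=; lia.
- apply/forallP => i; apply/forallP => r; apply/implyP.
  case: (unliftP ord0 i) => [j ->|->].
    rewrite lift0 /= addSn addn1 /= => /and3P[lt_l sn1 ones].
    have lt_rl : r < l by lia.
    have /forallP/(_ (Ordinal lt_rl))/implyP := H3 j.
    by rewrite /= addn1 sn1 ones -ltnS lt_l; apply.
  rewrite /= add0n addn1 /= drop0 ltnS => /and3P[lt_l an1 ones].
  have /implyP := H2 (Ordinal lt_l).
  by rewrite /= (negPf an1); apply.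
Qed.

Lemma in_A0 m a : in_A m 0 a = (a == [::]).
Proof.
apply/idP/eqP => [/and5P[/eqP/size0nil] // | ->].
by apply/and5P; split=> //; apply/forallP => -[].
Qed.

Fixpoint enum_A (m l : nat) : seq (seq nat) :=
  if l is l'.+1 then
    [seq a :: s | a <- iota 1 m, s <- enum_A (if a == 1 then m.+1 else a) l']
  else [:: [::]].

Lemma mem_enum_A m l s : (s \in enum_A m l) = in_A m l s.
Proof.
elim: l m s => [|l IH] m s; first by rewrite in_A0 inE.
apply/allpairsPdep/idP => [[a [s' [+ + ->]]] | ].
  by rewrite mem_iota IH in_A_cons => ? ->; rewrite andbT; lia.
case: s => [|a s]; first by case/and5P.
rewrite in_A_cons => /andP[le_am As]; exists a, s.
by rewrite mem_iota IH; split=> //; lia.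
Qed.

Lemma enum_A_uniq m l : uniq (enum_A m l).
Proof.
elim: l m => [|l IH] m //=.
apply: allpairs_uniq_dep => [|a _|]; [exact: iota_uniq | exact: IH |].
by move=> [a s] [b t] _ _ /= [-> ->].
Qed.

Lemma in_A_sumn m l s : in_A m l s -> l <= sumn s.
Proof.
case/and5P=> /eqP <- + _ _ _; elim: s => //= a s IH /andP[a_gt0 /IH]; lia.
Qed.

Lemma vals_inj N l : injective (@vals N l).
Proof. by move=> s t /(inj_map val_inj)/val_inj. Qed.

Local Open Scope ring_scope.

(** * Recursions for the polynomials A and B *)

(** Frees the sums from the tuple type, whose entry bound depends on [m] and [l] and may change when
    a letter is removed. *)
Lemma sum_vals N l (D : {set l.-tuple 'I_N}) (r : seq (seq nat))
    (R : nmodType) (F : seq nat -> R) :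
  uniq r -> (forall s, s \in r <-> exists2 t, t \in D & vals t = s) ->
  \sum_(t in D) F (vals t) = \sum_(s <- r) F s.
Proof.
move=> r_uniq rE; rewrite -big_enum /= -(big_map (@vals N l) xpredT).
apply: perm_big; apply: uniq_perm => // [|s].
  by rewrite map_inj_uniq ?enum_uniq //; apply: vals_inj.
apply/mapP/idP => [[t + ->] | /rE[t Dt <-]]; last by exists t; rewrite ?mem_enum.
by rewrite mem_enum => Dt; apply/rE; exists t.
Qed.

Lemma A_polyE m l : A_poly m l = \sum_(s <- enum_A m l) 'X^(sumn s - l).
Proof.
apply: (sum_vals (fun s => 'X^(sumn s - l)) (enum_A_uniq m l)) => s.
by rewrite mem_enum_A A_set_complete.
Qed.

Lemma B_polyE m l :
  B_poly m l = \sum_(s <- enum_A m l | ohead s != Some 1%N) 'X^(sumn s - l).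
Proof.
rewrite -big_filter.
apply: (sum_vals (fun s => 'X^(sumn s - l))) => [|s].
  by rewrite filter_uniq ?enum_A_uniq.
by rewrite mem_filter mem_enum_A andbC -/(in_B m l s) B_set_complete.
Qed.

Lemma A_poly0 m : A_poly m 0 = 1.
Proof. by rewrite A_polyE big_seq1. Qed.

Lemma B_poly0 m : B_poly m 0 = 1.
Proof. by rewrite B_polyE big_mkcond big_seq1. Qed.

Lemma sum_enum_A_cons m l a :
  \sum_(s <- enum_A m l) 'X^(a.+1 + sumn s - l.+1) = 'X^a * A_poly m l.
Proof.
rewrite A_polyE big_distrr big_seq_cond [RHS]big_seq_cond; apply: eq_bigr => s /andP[+ _].
(* The bound [l <= sumn s] keeps the subtraction in the exponent from truncating. *)
rewrite mem_enum_A => /in_A_sumn le_ls /=.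
by rewrite -exprD; congr ('X^_); lia.
Qed.

Lemma A_polyS m l :
  A_poly m l.+1 =
  \sum_(a < m) 'X^a * A_poly (if a == 0 :> nat then m.+1 else a.+1) l.
Proof.
rewrite A_polyE big_allpairs_dep /= -[1%N]addn0 iotaDl big_map.
rewrite -(big_mkord xpredT (fun a => 'X^a * A_poly (if a == 0%N then m.+1 else a.+1) l)).
rewrite /index_iota subn0; apply: eq_bigr => a _.
by rewrite add1n sum_enum_A_cons.
Qed.

Lemma B_polyS m l :
  B_poly m l.+1 = \sum_(a < m | a != 0 :> nat) 'X^a * A_poly a.+1 l.
Proof.
rewrite B_polyE big_mkcond big_allpairs_dep /= -[1%N]addn0 iotaDl big_map.
rewrite -(big_mkord (fun a => a != 0)%N (fun a => 'X^a * A_poly a.+1 l)).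
rewrite /index_iota subn0 [RHS]big_mkcond; apply: eq_bigr => a _.
case: a => [|a]; first by rewrite big1.
by rewrite add1n sum_enum_A_cons.
Qed.

(** The first letter would have to be 1, which B forbids. This removes the term [j = 0] in the final
    identity. *)
Lemma B_poly1S l : B_poly 1 l.+1 = 0.
Proof. by rewrite B_polyS big_pred0 // => a; rewrite ord1. Qed.

(** * Summing over involutions by their last adjoined cycle *)

(* Contribution of the descendants of s after adjoining l cycles: by the header
   they are indexed by A_{c,l} with c = n + 1 - max_low s, provided that s is not
   decreasing. *)
Definition label_term n l (s : 'S_n) : {poly int} :=
  'X^(coinv s) * (A_poly (n.+1 - max_low s) l \Po 'X^2).

Definition label_sum n l : {poly int} :=
  \sum_(s in involutions_avoiding n pattern123 | (0 < max_low s)%N) label_term l s.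

Lemma Xn_comp_sqr a : ('X^a : {poly int}) \Po 'X^2 = 'X^(2 * a).
Proof. by rewrite comp_Xn_poly -exprM. Qed.

Lemma sum_children n l (t : 'S_n) : (0 < max_low t)%N ->
  \sum_(w < n.+1 | (max_low t <= w)%N) label_term l (add_cycle w t) =
  label_term l.+1 t.
Proof.
move=> h_gt0; rewrite /label_term A_polyS raddf_sum mulr_sumr /=.
pose F a := 'X^(coinv t) * (('X^a * A_poly
  (if a == 0%N then (n.+1 - max_low t).+1 else a.+1) l) \Po 'X^2).
(* Reversal matches the cycle parameter with the letter minus one; their sum is [n]. *)
rewrite (big_ord_widen n.+1 F) ?leq_subr // (reindex_inj rev_ord_inj) /=.
apply: eq_big => [w | w le_hw]; first by have := ltn_ord w; lia.
rewrite /F comp_polyM Xn_comp_sqr mulrA -exprD coinv_add_cycle /=.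
have -> : (n - (n.+1 - w.+1) = w)%N by have := ltn_ord w; lia.
(* For the letter 1 the size grows by two and [max_low] by one, so the label grows by one; otherwise
   the label becomes the letter [w + 1]. *)
congr (_ * (A_poly _ _ \Po _)); case: eqP => [w0 | /eqP w_neq0].
  rewrite (_ : rev_ord w = ord_max); last by apply: val_inj; rewrite /= w0 subn1.
  rewrite max_low_add_cycle_max h_gt0.
  have := ltn_ord w; lia.
rewrite max_low_add_cycle_lt //=; have := ltn_ord w; lia.
Qed.

(** The omitted parameter [w = n], the letter 1, gives a decreasing permutation again; hence B
    instead of A. *)
Lemma sum_children_rev n l :
  \sum_(w < n.+1 | (w < n)%N) label_term l (add_cycle w (rev_perm n)) =
  B_poly n.+1 l.+1 \Po 'X^2.
Proof.
rewrite B_polyS raddf_sum /= (reindex_inj rev_ord_inj) /=.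
apply: eq_big => [w | w lt_wn]; first by have := ltn_ord w; lia.
rewrite comp_polyM Xn_comp_sqr /label_term coinv_add_cycle coinv_rev add0n.
rewrite max_low_add_cycle_lt ?max_low_rev //.
by congr ('X^_ * (A_poly _ _ \Po _)) => /=; have := ltn_ord w; lia.
Qed.

Lemma add_cycle_in_involutions123 n (w : 'I_n.+1) (t : 'S_n) :
  (add_cycle w t \in involutions_avoiding n.+2 pattern123) =
  (t \in involutions_avoiding n pattern123) && (max_low t <= w)%N.
Proof.
apply/in_involutions123/andP => [[/add_cycle_involutive inv] | ].
  by move/(add_cycle_triple_free w inv) => [av ?]; split=> //; apply/in_involutions123.
case=> /in_involutions123[inv av] le_hw; split; first exact/add_cycle_involutive.
exact/add_cycle_triple_free.
Qed.

Lemma max_low_add_cycle_gt0 n (w : 'I_n.+1) (t : 'S_n) : (max_low t <= w)%N ->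
  (0 < max_low (add_cycle w t))%N = (0 < max_low t)%N || (w < n)%N.
Proof.
move=> le_hw; case: (ltnP w n) => [lt_wn | le_nw].
  by rewrite max_low_add_cycle_lt // orbT.
rewrite (_ : w = ord_max); last by apply: val_inj => /=; have := ltn_ord w; lia.
by rewrite max_low_add_cycle_max orbF; lia.
Qed.

(** The three terms come from the non-decreasing parents, the decreasing parent, and the involution
    fixing the first point, which has no parent. *)
Lemma label_sumSS n l :
  label_sum n.+2 l = label_sum n l.+1 + (B_poly n.+1 l.+1 \Po 'X^2)
                     + 'X^(n.+1) * (A_poly n.+2 l \Po 'X^2).
Proof.
rewrite {1}/label_sum (bigID (fun s : 'S_n.+2 => s ord0 == ord0)) /= addrC.
congr (_ + _); last first.
  rewrite (big_pred1 (fix0_rev n.+1)) => [|s].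
    by rewrite /label_term coinv_fix0_rev max_low_fix0_rev subSS subn0.
  rewrite /= andbAC fix0_involution123; case: eqP => // ->.
  by rewrite max_low_fix0_rev.
pose D := [set x : 'S_n * 'I_n.+1 |
  (x.1 \in involutions_avoiding n pattern123) &&
  ((max_low x.1 <= x.2) && ((0 < max_low x.1) || (x.2 < n)))%N].
pose f (x : 'S_n * 'I_n.+1) := add_cycle x.2 x.1.
rewrite (eq_bigl (mem (f @: D))); last first.
  move=> s; apply/idP/imsetP => [/andP[/andP[Is h_gt0] s0] | [[t w] + ->]].
    have [inv _] := in_involutions123 _ Is.
    have [w [t sE]] := add_cycle_surj inv s0.
    exists (t, w) => //; move: Is h_gt0; rewrite sE add_cycle_in_involutions123.
    by case/andP=> It le_hw; rewrite max_low_add_cycle_gt0 // inE /= It le_hw.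
  rewrite inE /= /f /= add_cycle_in_involutions123 => /and3P[-> le_hw].
  by rewrite le_hw max_low_add_cycle_gt0 // => ->; rewrite add_cycle_first.
rewrite big_imset /=; last first.
  by move=> [t w] [t' w'] _ _ /add_cycle_inj /= [-> ->].
transitivity (\sum_(t in involutions_avoiding n pattern123)
    \sum_(w < n.+1 | ((max_low t <= w) && ((0 < max_low t) || (w < n)))%N)
      label_term l (add_cycle w t)).
  by rewrite pair_big_dep /=; apply: eq_bigl => x; rewrite inE.
rewrite (bigID (fun t : 'S_n => 0 < max_low t)%N) /=; congr (_ + _).
  apply: eq_bigr => t /andP[_ h_gt0]; rewrite -sum_children //.
  by apply: eq_bigl => w; rewrite h_gt0 andbT.
rewrite (big_pred1 (rev_perm n)) => [|t].
  by rewrite -sum_children_rev; apply: eq_bigl => w; rewrite max_low_rev.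
rewrite /= -eqn0Ngt max_low_eq0; case: eqP => [->|]; last by rewrite andbF.
by rewrite rev_perm_involution123.
Qed.

Lemma label_sum0 l : label_sum 0 l = 0.
Proof.
rewrite /label_sum big1 // => s /andP[_].
by rewrite lt0n max_low_eq0 => /eqP[]; apply/permP => -[].
Qed.

(** Iterates [label_sumSS] down to size 0; [l] stays general because each descent lengthens the
    sequences by one letter. *)
Lemma label_sum_even k l :
  label_sum (2 * k) l =
  \sum_(0 <= j < k) (B_poly (2 * j + 1) (l + (k - j)) \Po 'X^2)
  + \sum_(0 <= j < k) 'X^(2 * j + 1) * (A_poly (2 * j + 2) (l + (k - j.+1)) \Po 'X^2).
Proof.
elim: k l => [|k IH] l; first by rewrite muln0 label_sum0 !big_geq // addr0.
rewrite mulnS add2n label_sumSS IH !big_nat_recr //= subSnn subnn addn0 !addn1 !addn2.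
rewrite -addrA addrACA; congr (_ + _ + (_ + _)); apply: eq_big_nat => j /andP[_ lt_jk].
  by have -> : (l.+1 + (k - j) = l + (k.+1 - j))%N by lia.
by have -> : (l.+1 + (k - j.+1) = l + (k.+1 - j.+1))%N by lia.
Qed.

Theorem theorem3p21 (k : nat) (hk : (1 <= k)%N) :
  \sum_(s in involutions_avoiding (2 * k) pattern123) 'X^(coinv s) =
    \sum_(1 <= j < k.+1) (B_poly (2 * j + 1) (k - j) \Po 'X^2)
    + \sum_(1 <= j < k.+1) 'X^(2 * j - 1) * (A_poly (2 * j) (k - j) \Po 'X^2)
    :> {poly int}.
Proof.
rewrite (bigID (fun s : 'S_(2 * k) => 0 < max_low s)%N) /=.
rewrite (eq_bigr (label_term 0)) => [|s _]; last first.
  by rewrite /label_term A_poly0 comp_polyC mulr1.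
rewrite -/(label_sum (2 * k) 0) label_sum_even.
rewrite (big_pred1 (rev_perm (2 * k))) => [|s]; last first.
  rewrite /= -eqn0Ngt max_low_eq0; case: eqP => [->|]; last by rewrite andbF.
  by rewrite rev_perm_involution123.
rewrite coinv_rev addrAC; congr (_ + _).
  (* The decreasing permutation contributes 1, the term [j = k] of the first sum. *)
  rewrite big_nat_recr //= subnn B_poly0 comp_polyC; congr (_ + _).
  (* As [k] is positive, the extra term [j = 0] is B with bound 1 and positive length, hence
     zero. *)
  rewrite big_ltn // subn0; case: k hk => // k _.
  rewrite muln0 !add0n B_poly1S comp_poly0 add0r.
  by apply: eq_big_nat => j _; rewrite add0n.
rewrite [RHS]big_add1 /=; apply: eq_big_nat => j _.
have -> : (2 * j.+1 - 1 = 2 * j + 1)%N by lia.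
by have -> : (2 * j.+1 = 2 * j + 2)%N by lia.
Qed.
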